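(* Let $X$ be a finite-dimensional real normed space, $Y$ a real Banach space, $A\subseteq X$ a nonempty closed convex set, $C\subseteq Y$ a closed convex cone with nonempty interior, and $F:X\to Y$ a (continuous) linear map with $F(X)\cap\operatorname{int}C\neq\emptyset$. Let $\theta$ be the associated merit function, assumed to satisfy $\theta(x)<+\infty$ for all $x\in X$, and let $\bar x\in E_w$. Let $\varphi(\bar x)=\inf\{\theta'(\bar x;d): d\in T_A(\bar x),\ \|d\|=1\}$ and $$\tau^*(\bar x)=\inf\{\tau>0:\exists\delta>0,\ \forall x\in A\cap B(\bar x,\delta),\ d(x,E_w)\le\tau\theta(x)\}\quad(\inf\emptyset=+\infty).$$ Then: (i) If $\varphi(\bar x)>0$, then $\theta$ has a local error bound at $\bar x$ and $\tau^*(\bar x)=\dfrac{1}{\varphi(\bar x)}<+\infty$. (ii) If $\varphi(\bar x)=0$ and there exists a direction $d_0\in T_A(\bar x)\setminus T_{E_w}(\bar x)$ with $\theta'(\bar x;d_0)=0$, then $\theta$ does not admit a local error bound at $\bar x$, i.e. $\tau^*(\bar x)=+\infty$.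
   Context: $d(x,D)=d_D(x)=\inf_{u\in D}\|x-u\|$ with $d_\emptyset\equiv+\infty$; $\Delta_D(y)=d_D(y)-d_{Y\setminus D}(y)$ with conventions $\Delta_\emptyset\equiv+\infty$, $\Delta_Y\equiv-\infty$. $C^+=\{y^*\in Y^*:\langle y^*,c\rangle\ge 0\ \forall c\in C\}$, $S(C^+)=\{y^*\in C^+:\|y^*\|=1\}$. The merit function is $$\theta(x)=\sup_{a\in A}\bigl(-\Delta_C(F(x)-F(a))\bigr)=\sup_{a\in A}\inf_{y^*\in S(C^+)}\langle y^*,F(x)-F(a)\rangle .$$ $E_w=\{\bar x\in A: F(\bar x)\notin F(A)+\operatorname{int}C\}$ is the weakly efficient solution set. For a nonempty set $D\subseteq X$ and $x\in D$, $T_D(x)=\{d\in X:\exists t_k\downarrow0,\ \exists d_k\to d,\ x+t_kd_k\in D\}$. $\theta'(x;d)=\lim_{t\downarrow0}\frac{\theta(x+td)-\theta(x)}{t}$, which exists and is finite since $\theta$ is concave and Lipschitz. $\theta$ has a local error bound at $x_0\in E_w$ if there exist $\tau>0$, $\delta>0$ with $d(x,E_w)\le\tau\theta(x)$ for all $x\in A\cap B(x_0,\delta)$ (open ball). In the degenerate case $T_A(\bar x)=\{0\}$ one has $\varphi(\bar x)=\inf\emptyset=+\infty$ and $1/(+\infty)$ is read as $0$. *)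

(* Defs.v *)
From HB Require Import structures.
From mathcomp Require Import all_boot all_order all_algebra.
From mathcomp Require Import all_classical all_reals all_analysis.

Set Implicit Arguments.
Unset Strict Implicit.
Unset Printing Implicit Defensive.

Import Order.TTheory GRing.Theory Num.Theory.
Import numFieldNormedType.Exports.

Local Open Scope classical_set_scope.
Local Open Scope ring_scope.

Definition finite_dimensional (R : realType) (X : lmodType R) : Prop :=
  exists (n : nat) (e : 'I_n -> X),
    forall x : X, exists c : 'I_n -> R, x = \sum_(i < n) c i *: e i.

Definition is_cone (R : realType) (Y : lmodType R) (C : set Y) : Prop :=
  forall (t : R) (c : Y), 0 <= t -> C c -> C (t *: c).

Section Distance.
Context {R : realType} {V : normedModType R}.

(* The infimum is taken in \bar R, so that d(x, set0) = +oo. *)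
Definition dist_set (x : V) (D : set V) : \bar R :=
  ereal_inf [set (`|x - u|)%:E | u in D].

(* Hiriart-Urruty oriented distance.  The values +oo for D = set0 and -oo for
   D = setT come from dist_set y set0 = +oo, since the distance from y to the
   whole space is 0. *)
Definition oriented_dist (D : set V) (y : V) : \bar R :=
  (dist_set y D - dist_set y (~` D))%E.

(* Bouligand tangent (contingent) cone; t_k decreases to 0 in the usual sense
   that t_k > 0 and t_k tends to 0. *)
Definition tangent_cone (D : set V) (x : V) : set V :=
  [set d | exists (t : nat -> R) (dk : nat -> V),
     [/\ forall k, 0 < t k, t @ \oo --> 0, dk @ \oo --> d &
         forall k, D (x + t k *: dk k)]].

End Distance.

Section VectorOptimization.
Context {R : realType} {X Y : normedModType R}.
Variables (A : set X) (C : set Y) (F : X -> Y).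

Definition weakly_efficient : set X :=
  [set x | A x /\ ~ [set y + c | y in F @` A & c in interior C] (F x)].

Definition merit (x : X) : \bar R :=
  ereal_sup [set (- oriented_dist C (F x - F a)%R)%E | a in A].

(* Real-valued because the merit function is assumed to be finite wherever
   this is used; fine is harmless under that assumption. *)
Definition merit_dderiv (x d : X) : R :=
  lim ((fine (merit (x + t *: d)) - fine (merit x)) / t @[t --> 0^'+]).

Definition error_bound_const (x0 : X) (tau : R) : Prop :=
  exists2 delta : R, 0 < delta &
    forall x, A x -> ball x0 delta x ->
      (dist_set x weakly_efficient <= tau%:E * merit x)%E.

Definition local_error_bound (x0 : X) : Prop :=
  exists2 tau : R, 0 < tau & error_bound_const x0 tau.

Definition error_bound_modulus (x0 : X) : \bar R :=
  ereal_inf (EFin @` [set tau : R | 0 < tau /\ error_bound_const x0 tau]).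

Definition min_slope (x : X) : \bar R :=
  ereal_inf [set (merit_dderiv x d)%:E |
             d in [set d : X | tangent_cone A x d /\ `|d| = 1]].

End VectorOptimization.

(* Main.v *)
(* theta is Lipschitz, and along rays from the efficient point x it satisfies
   (s/t) theta(x + t d) <= theta(x + s d) for 0 < s <= t, so the quotients
   theta(x + t d') / t converge to theta'(x; d) as (d', t) -> (d, 0+).  By
   compactness of the unit sphere, for every M below the minimal slope phi one
   has M |y - x| <= theta(y) on A near x.  This gives the error bound with any
   constant above 1/phi and isolates x in E_w, so that near x the distance to
   E_w is |y - x|; evaluating the error bound along a sequence realizing a
   tangent direction d then yields 1/tau <= theta'(x; d).  In (ii), an error
   bound along such a sequence for d0 would put points of E_w within o(t_k) of
   x + t_k d_k, making d0 tangent to E_w. *)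

Require Import Defs.
From HB Require Import structures.
From mathcomp Require Import all_boot all_order all_algebra.
From mathcomp Require Import all_classical all_reals all_analysis.
From mathcomp Require Import lra.

Set Implicit Arguments.
Unset Strict Implicit.
Unset Printing Implicit Defensive.

Import Order.TTheory GRing.Theory Num.Theory.
Import numFieldNormedType.Exports.

Local Open Scope classical_set_scope.
Local Open Scope ring_scope.

(** * Compactness of the unit sphere in finite dimension *)

(** A spanning family of least size is free: a relation with [c j] nonzero expresses [e j] through
    the other vectors, which would then span already. *)
Lemma spanning_min_free (R : realType) (X : lmodType R) :
  finite_dimensional X ->
  exists (n : nat) (e : 'I_n -> X),
    (forall x : X, exists c : 'I_n -> R, x = \sum_(i < n) c i *: e i) /\
    (forall c : 'I_n -> R, \sum_(i < n) c i *: e i = 0 -> forall i, c i = 0).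
Proof.
pose spans n (e : 'I_n -> X) :=
  forall x : X, exists c : 'I_n -> R, x = \sum_(i < n) c i *: e i.
move=> [m [e0 e0P]].
have ex_n : exists n, `[< exists e : 'I_n -> X, spans n e >].
  by exists m; apply/asboolP; exists e0.
case: (ex_minnP ex_n) => n /asboolP[e eP] n_min; exists n, e; split=> // c c0 j.
apply/eqP; apply: contraT => cj.
case: n => [|n] in e eP n_min c c0 j cj *; first by case: j {cj}.
have := n_min n; rewrite ltnn => -> //.
apply/asboolP; exists (fun i => e (lift j i)) => x.
have [b ->] := eP x.
have ej : e j = - \sum_(i < n) (c (lift j i) / c j) *: e (lift j i).
  have := congr1 ( *:%R (c j)^-1) c0.
  rewrite (bigD1_ord j)//= scalerDr scalerA mulVf// scale1r scaler0 => /eqP.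
  rewrite addr_eq0 => /eqP ->; congr (- _); rewrite scaler_sumr.
  by apply: eq_bigr => i _; rewrite scalerA mulrC.
exists (fun i => b (lift j i) - b j * (c (lift j i) / c j)).
rewrite (bigD1_ord j)//= ej scalerN scaler_sumr addrC -sumrB.
by apply: eq_bigr => i _; rewrite scalerBl scalerA.
Qed.

(** Transfer from ['rV[R]_n] along the coordinate map [f]. Freeness makes the minimum of [|f v|] on
    the unit sphere of row vectors positive, so the sphere of [X] is a closed subset of the
    [f]-image of a compact ball. *)
Lemma compact_sphere (R : realType) (X : normedModType R) :
  finite_dimensional X -> compact [set d : X | `|d| = 1].
Proof.
move=> /spanning_min_free[n [e [span_e free_e]]].
pose f (v : 'rV[R]_n) : X := \sum_(i < n) v ord0 i *: e i.
have f_cont : continuous f.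
  apply: continuous_big => [|i _ v]; first exact: add_continuous.
  exact: (cvgZr_tmp (@coord_continuous R 1 n ord0 i v)).
have fZ a v : f (a *: v) = a *: f v.
  by rewrite /f scaler_sumr; apply: eq_bigr => i _; rewrite mxE scalerA.
have sphere_closed (V : normedModType R) : closed [set d : V | `|d| = 1].
  have -> : [set d : V | `|d| = 1] = Num.norm @^-1` [set 1] by [].
  apply: closed_comp; last exact: closed_eq.
  by move=> d _; exact: norm_continuous.
have bounded_rV (r : R) : compact [set v : 'rV[R]_n | `|v| <= r].
  apply: bounded_closed_compact.
    exists r; split=> [|M rM v /= vr]; first exact: num_real.
    exact: le_trans vr (ltW rM).
  have -> : [set v : 'rV[R]_n | `|v| <= r] = Num.norm @^-1` [set x | x <= r] by [].
  apply: closed_comp; last exact: closed_le.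
  by move=> d _; exact: norm_continuous.
have unit_rV (d : X) : `|d| = 1 -> exists2 v : 'rV[R]_n, f v = d & 0 < `|v|.
  move=> d1; have [c dE] := span_e d; exists (\row_i c i).
    by rewrite dE; apply: eq_bigr => i _; rewrite mxE.
  rewrite normr_gt0; apply/eqP => /rowP c0; move: d1; rewrite dE big1 ?normr0.
    by move/esym/eqP; rewrite oner_eq0.
  by move=> i _; have := c0 i; rewrite !mxE => ->; rewrite scale0r.
have normalize (v : 'rV[R]_n) : 0 < `|v| -> `| `|v|^-1 *: v| = 1.
  by move=> v0; rewrite normrZ normfV normr_id mulVf// gt_eqF.
(* The extreme value theorem needs a nonempty sphere; when it is empty, so is the sphere of [X]. *)
have [[v0 v01]|S0] := pselect ([set v : 'rV[R]_n | `|v| = 1] !=set0); last first.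
  have -> : [set d : X | `|d| = 1] = set0; last exact: compact0.
  rewrite -subset0 => d /unit_rV[v _ v0]; apply: S0.
  by exists (`|v|^-1 *: v); exact: normalize.
have [|||v v1 v_min] := @EVT_min_rV R n (fun v => `|f v|) [set v | `|v| = 1].
- by exists v0.
- apply: subclosed_compact (bounded_rV 1) _; first exact: sphere_closed.
  by move=> v /= ->.
- apply: continuous_subspaceT => v; apply: continuous_comp; first exact: f_cont.
  exact: norm_continuous.
move: v1; rewrite inE/= => v1.
have fv0 : 0 < `|f v|.
  rewrite normr_gt0; apply/eqP => /free_e v_eq0; move: v1.
  rewrite (_ : v = 0) ?normr0; first by move/esym/eqP; rewrite oner_eq0.
  by apply/rowP => i; rewrite v_eq0 mxE.
apply: (@subclosed_compact _ _ (f @` [set w | `|w| <= `|f v|^-1])).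
- exact: sphere_closed.
- apply: continuous_compact; last exact: bounded_rV.
  exact: continuous_subspaceT.
(* Minimality of [v], tested at [w] normalized, gives [|f v| <= 1 / |w|]. *)
- move=> d d1; have [w wd w0] := unit_rV _ d1; exists w => //=.
  have := v_min (`|w|^-1 *: w); rewrite inE/= => /(_ (normalize _ w0)).
  rewrite fZ normrZ normfV normr_id wd d1 mulr1.
  by rewrite -[leLHS]invrK lef_pV2// posrE invr_gt0.
Qed.

(** * Distance to a set *)

Lemma dist_set_ge0 (R : realType) (V : normedModType R) (D : set V) (x : V) :
  (0 <= dist_set x D)%E.
Proof. by apply/ereal_infP => _ [u _ <-]; rewrite lee_fin. Qed.

Lemma dist_set_le (R : realType) (V : normedModType R) (D : set V) (x u : V) :
  D u -> (dist_set x D <= (`|x - u|)%:E)%E.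
Proof. by move=> Du; apply: ereal_inf_lbound; exists u. Qed.

Lemma dist_set_lt (R : realType) (V : normedModType R) (D : set V) (x : V) (r : R) :
  (dist_set x D < r%:E)%E -> exists2 u, D u & `|x - u| < r.
Proof. by move=> /ereal_inf_lt[_ [u Du <-]]; rewrite lte_fin; exists u. Qed.

Lemma dist_set_fin_num (R : realType) (V : normedModType R) (D : set V) (x : V) :
  D !=set0 -> dist_set x D \is a fin_num.
Proof.
move=> [u Du]; rewrite ge0_fin_numE ?dist_set_ge0//.
by rewrite (le_lt_trans (dist_set_le x Du))// ltry.
Qed.

Lemma dist_set_lipschitz (R : realType) (V : normedModType R) (D : set V) (x y : V) :
  (dist_set x D <= dist_set y D + (`|x - y|)%:E)%E.
Proof.
rewrite -leeBlDr//; apply/ereal_infP => _ [u Du <-].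
rewrite leeBlDr// (le_trans (dist_set_le x Du))// -EFinD lee_fin.
by rewrite [leRHS]addrC; exact: ler_distD.
Qed.

Lemma dist_setZ_le (R : realType) (V : normedModType R) (D : set V) (t : R) (x : V) :
  0 < t -> (forall u, D u -> D (t *: u)) ->
  (dist_set (t *: x) D <= t%:E * dist_set x D)%E.
Proof.
move=> t0 Dt; rewrite /dist_set -(ereal_inf_pZl _ t0).
apply/ereal_infP => _ [_ [u Du <-] <-].
by rewrite -EFinM -(gtr0_norm t0) -normrZ scalerBr gtr0_norm// dist_set_le//; apply: Dt.
Qed.

(** The reverse inequality is [dist_setZ_le] for the factor [t^-1] at the point [t *: x]. *)
Lemma dist_setZ (R : realType) (V : normedModType R) (D : set V) (t : R) (x : V) :
  0 < t -> (forall s u, 0 < s -> D u -> D (s *: u)) ->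
  (dist_set (t *: x) D = t%:E * dist_set x D)%E.
Proof.
move=> t0 Dc; apply/eqP; rewrite eq_le dist_setZ_le//=; last first.
  by move=> u; exact: Dc.
have ti0 : 0 < t^-1 by rewrite invr_gt0.
have := @dist_setZ_le _ _ D t^-1 (t *: x) ti0 (fun u => @Dc _ u ti0).
rewrite scalerA mulVf ?gt_eqF// scale1r.
rewrite -(lee_pmul2l _ (_ : 0 < t%:E)%E)//.
by rewrite muleA -EFinM divff ?gt_eqF// mul1e.
Qed.

(** * The oriented distance as a real function *)

(** This is the negated oriented distance; [fine] loses nothing once [C] and its complement are both
    nonempty. *)
Definition depth (R : realType) (V : normedModType R) (C : set V) (y : V) : R :=
  fine (dist_set y (~` C)) - fine (dist_set y C).

Section Depth.
Context {R : realType} {V : normedModType R} {C : set V}.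
Hypotheses (C_neq0 : C !=set0) (C_neqT : ~` C !=set0).

Lemma oriented_distE (y : V) : oriented_dist C y = (- depth C y)%:E.
Proof.
by rewrite /oriented_dist /depth opprB EFinB !fineK ?dist_set_fin_num.
Qed.

Lemma depth_lipschitz (x y : V) : depth C x <= depth C y + 2 * `|x - y|.
Proof.
have := dist_set_lipschitz (~` C) x y; have := dist_set_lipschitz C y x.
rewrite /depth -(fineK (dist_set_fin_num x C_neq0)) -(fineK (dist_set_fin_num y C_neq0)).
rewrite -(fineK (dist_set_fin_num x C_neqT)) -(fineK (dist_set_fin_num y C_neqT)) /=.
rewrite -!EFinD !lee_fin (distrC y x); lra.
Qed.

(** If the depth is positive, the ball whose radius is the distance to the complement lies in [C].
    Conversely, a ball inside [C] makes the distance to [C] zero and the distance to the complement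
    at least its radius. *)
Lemma depth_gt0P (y : V) : 0 < depth C y <-> interior C y.
Proof.
split=> [|/nbhs_ballP[r r0 rC]].
  rewrite subr_gt0 => lt_dist; rewrite /interior/= nbhs_ballP.
  exists (fine (dist_set y (~` C))) => /=.
    by apply: le_lt_trans lt_dist; rewrite fine_ge0// dist_set_ge0.
  move=> z; rewrite -ball_normE/= => yz; apply: contrapT => Cz.
  have := @dist_set_le _ _ (~` C) y z Cz; rewrite -(fineK (dist_set_fin_num y C_neqT)) lee_fin.
  by rewrite leNgt yz.
have Cy : C y by apply: rC; exact: ballxx.
have -> : depth C y = fine (dist_set y (~` C)).
  have : (dist_set y C <= 0)%E by have := dist_set_le y Cy; rewrite subrr normr0.
  rewrite /depth => d0; have -> : dist_set y C = 0%E.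
    by apply/eqP; rewrite eq_le d0 dist_set_ge0.
  by rewrite subr0.
apply: lt_le_trans r0 _; rewrite -lee_fin fineK ?dist_set_fin_num//.
apply/ereal_infP => _ [u Cu <-]; rewrite lee_fin leNgt; apply/negP => yu.
by apply: Cu; apply: rC; rewrite -ball_normE.
Qed.

Hypothesis C_cone : is_cone C.

Lemma depthZ (t : R) (y : V) : 0 < t -> depth C (t *: y) = t * depth C y.
Proof.
move=> t0; rewrite /depth !dist_setZ//.
- by rewrite !fineM ?dist_set_fin_num// mulrBr.
- by move=> s u s0; apply: C_cone; exact: ltW.
(* The complement of a cone is also stable under positive scaling. *)
- move=> s u s0 Cu Csu; apply: Cu.
  rewrite -[u](scalerK (lt0r_neq0 s0)); apply: C_cone => //.
  by rewrite invr_ge0 ltW.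
Qed.

Lemma depth0 : depth C 0 = 0.
Proof.
have /(depthZ 0) : 0 < 2 :> R by [].
rewrite scaler0; lra.
Qed.

End Depth.

(** * Tangent directions and their sequences *)

(** Otherwise every product neighbourhood of size [1/(k+1)] contains a pair that reaches [D], and
    these pairs form a sequence making [d] tangent. This disposes of the non-tangent directions on
    the sphere. *)
Lemma tangent_coneNnear (R : realType) (X : normedModType R) (x d : X) (D : set X) :
  ~ tangent_cone D x d ->
  \forall d' \near d & t \near 0^'+, ~ D (x + t *: d').
Proof.
move=> Td; apply: contrapT => nnear; apply: Td.
have /choice[p pP] (k : nat) : exists p : X * R,
    [/\ 0 < p.2, p.2 < k.+1%:R^-1, `|d - p.1| < k.+1%:R^-1 & D (x + p.2 *: p.1)].
  apply: contrapT => np; apply: nnear.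
  have k0 : 0 < k.+1%:R^-1 :> R by [].
  exists ([set d' | `|d - d'| < k.+1%:R^-1], [set t | 0 < t < k.+1%:R^-1]).
    split=> /=.
      apply/nbhs_ballP; exists (k.+1%:R^-1) => // d'.
      by rewrite -ball_normE.
    near=> t; apply/andP; split; near: t; [exact: nbhs_right_gt|exact: nbhs_right_lt].
  move=> [d' t] /= [dd' /andP[t0 tk]] Dx; apply: np.
  by exists (d', t).
have inv0 : (fun k => k.+1%:R^-1 : R) @ \oo --> (0 : R) by exact: cvg_harmonic.
exists (fun k => (p k).2), (fun k => (p k).1); split.
- by move=> k; have [] := pP k.
- apply: (squeeze_cvgr _ (cvg_cst 0) inv0); near=> k.
  by have [/ltW -> /ltW ->] := pP k.
- apply/cvgrPdist_lt => e e0; near=> k.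
  have [_ _ pk _] := pP k; apply: lt_trans pk _.
  near: k; exact: (near_infty_natSinv_lt (PosNum e0)).
- by move=> k; have [] := pP k.
Unshelve. all: by end_near. Qed.

Lemma near_scaled_norm_lt (R : realType) (X : normedModType R) (d : X)
    (t : nat -> R) (dk : nat -> X) (delta : R) :
  0 < delta -> t @ \oo --> 0 -> dk @ \oo --> d ->
  \forall k \near \oo, `|t k *: dk k| < delta.
Proof.
move=> delta0 t0 dkd.
have : t k *: dk k @[k --> \oo] --> (0 : X) by rewrite -(scale0r d); exact: cvgZ.
move=> /cvgrPdist_lt/(_ _ delta0).
by apply: filterS => k; rewrite sub0r normrN.
Qed.

(** * Regularity and directional derivatives of the merit function *)

Section Merit.
Context {R : realType} {X Y : normedModType R}.
Context {A : set X} {C : set Y} {F : {linear X -> Y}}.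
Hypotheses (A_neq0 : A !=set0) (A_convex : convex_set A).
Hypotheses (C_neq0 : C !=set0) (C_cone : is_cone C) (F_cont : continuous F).
Hypothesis merit_fin : forall x : X, (merit A C F x < +oo)%E.

Local Notation theta x := (fine (merit A C F x)).

(** For [C = setT] the distance to the empty complement is [+oo], which would make the merit
    infinite. *)
Lemma merit_fin_proper : ~` C !=set0.
Proof.
have [a Aa] := A_neq0; apply/set0P/eqP => CT.
have := merit_fin 0; rewrite ltNge => /negP; apply.
rewrite /merit; apply: ereal_sup_ubound; exists a => //.
rewrite /oriented_dist CT {2}/dist_set image_set0 ereal_inf0.
by rewrite -(fineK (dist_set_fin_num _ C_neq0)).
Qed.
Let C_neqT := merit_fin_proper.

Lemma meritE (x : X) :
  merit A C F x = ereal_sup [set (depth C (F x - F a))%:E | a in A].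
Proof.
by congr ereal_sup; apply: eq_imagel => a _; rewrite oriented_distE// -EFinN opprK.
Qed.

Lemma merit_fin_num (x : X) : merit A C F x \is a fin_num.
Proof.
have [a Aa] := A_neq0; apply: fin_real; rewrite merit_fin andbT.
rewrite meritE; apply: (@lt_le_trans _ _ (depth C (F x - F a))%:E); first exact: ltNyr.
by apply: ereal_sup_ubound; exists a.
Qed.

Lemma le_merit (x a : X) : A a -> depth C (F x - F a) <= theta x.
Proof.
move=> Aa; rewrite -lee_fin fineK ?merit_fin_num// meritE.
by apply: ereal_sup_ubound; exists a.
Qed.

Lemma merit_le (x : X) (r : R) :
  (forall a, A a -> depth C (F x - F a) <= r) -> theta x <= r.
Proof.
move=> le_r; rewrite -lee_fin fineK ?merit_fin_num// meritE.
by apply/ereal_supP => _ [a Aa <-]; rewrite lee_fin le_r.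
Qed.

Lemma merit_ge0 (x : X) : A x -> 0 <= theta x.
Proof. by move=> /(le_merit x); rewrite subrr depth0. Qed.

(** Taking [a = x] shows [theta x >= 0] on [A]; it is zero exactly when no [F x - F a] has positive
    depth, that is, lies in the interior of [C]. *)
Lemma weakly_efficientP (x : X) :
  weakly_efficient A C F x <-> A x /\ theta x = 0.
Proof.
split=> -[Ax]; last first.
  move=> tx0; split=> // -[_ [a Aa <-] [c Cc /(canRL (addKr _)) cE]].
  have /(depth_gt0P C_neqT) := Cc; rewrite ltNge => /negP; apply.
  by rewrite -tx0 cE addrC le_merit.
move=> nE; split=> //; apply/eqP; rewrite eq_le merit_ge0// andbT.
apply: merit_le => a Aa; rewrite leNgt; apply/negP => /(depth_gt0P C_neqT) Cxa.
by apply: nE; exists (F a); [exists a|exists (F x - F a)]; rewrite // addrC subrK.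
Qed.

(** [F] is bounded and [depth] is 2-Lipschitz, so the bound is uniform in [a] and survives the
    supremum. *)
Lemma merit_lipschitz :
  exists2 L : R, 0 < L & forall x y, theta x <= theta y + L * `|x - y|.
Proof.
have /linear_boundedP/pinfty_ex_gt0[M M0 FM] := continuous_linear_bounded 0 (@F_cont 0).
exists (2 * M); first by rewrite mulr_gt0.
move=> x y; apply: merit_le => a Aa.
apply: le_trans (depth_lipschitz C_neq0 C_neqT _ (F y - F a)) _.
apply: lerD; first exact: le_merit.
rewrite opprB addrA subrK -linearB -mulrA ler_pM2l//; exact: FM.
Qed.

(* The rays from [x] shrink towards [x], as do the competitors [a], since [A] is
   convex; [depth] is positively homogeneous, so this replaces concavity. *)
Lemma merit_ray (x d : X) (s t : R) : A x -> 0 < s -> s <= t ->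
  s / t * theta (x + t *: d) <= theta (x + s *: d).
Proof.
move=> Ax s0 st; have t0 : 0 < t := lt_le_trans s0 st.
have l0 : 0 < s / t by rewrite divr_gt0.
have l1 : s / t <= 1 by rewrite ler_pdivrMr// mul1r.
rewrite mulrC -ler_pdivlMr//; apply: merit_le => a Aa.
rewrite ler_pdivlMr// mulrC -depthZ//.
have Aal : A (s / t *: a + (1 - s / t) *: x).
  have /= := A_convex (Itv01 (ltW l0) l1) (mem_set Aa) (mem_set Ax).
  by rewrite inE.
suff -> : (s / t) *: (F (x + t *: d) - F a) =
    F (x + s *: d) - F (s / t *: a + (1 - s / t) *: x) by exact: le_merit.
rewrite -!linearB -linearZ; congr (F _).
rewrite scalerBr scalerDr scalerA divfK ?gt_eqF// scalerBl scale1r.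
rewrite opprD opprB [RHS]addrCA [x + _]addrC [s *: d + x + _]addrACA subrr addr0.
by rewrite [LHS]addrC [_ + s *: d]addrC.
Qed.

Lemma merit_dderiv_cvg (x d : X) : weakly_efficient A C F x ->
  theta (x + t *: d) / t @[t --> 0^'+] --> merit_dderiv A C F x d.
Proof.
move=> /weakly_efficientP[Ax tx0].
have [L L0 lip] := merit_lipschitz.
suff : cvg (theta (x + t *: d) / t @[t --> 0^'+]).
  have qE : (fun t => (theta (x + t *: d) - theta x) / t) =
            (fun t => theta (x + t *: d) / t).
    by apply/funext => t; rewrite tx0 subr0.
  by rewrite /merit_dderiv qE.
(* By [merit_ray] the quotient is nonincreasing in [t]; by the Lipschitz bound it is at most
   [L * |d|]. Hence it converges at [0^'+]. *)
apply: cvgP; apply: (@nonincreasing_at_right_cvgr _ _ 0 (BInfty R false)) => //.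
- move=> t s; rewrite !in_itv/= !andbT => t0 s0 st.
  by rewrite ler_pdivlMr// mulrC mulrA mulrAC merit_ray.
- exists (L * `|d|) => _ [t /= + <-]; rewrite in_itv/= andbT => t0.
  rewrite ler_pdivrMr//; apply: le_trans (lip _ x) _.
  by rewrite tx0 add0r addrC addKr normrZ gtr0_norm// -mulrA [t * _]mulrC.
Qed.

(** Replacing [d] by [d'] changes the quotient by at most [L * |d - d'|], uniformly in [t], so the
    radial limit is also a joint limit. *)
Lemma merit_hadamard (x d : X) : weakly_efficient A C F x ->
  theta (x + p.2 *: p.1) / p.2 @[p --> (nbhs d, 0^'+)] -->
    merit_dderiv A C F x d.
Proof.
move=> Ex; have [L L0 lip] := merit_lipschitz.
apply/cvgrPdist_lt => e e0; have e20 : 0 < e / 2 by rewrite divr_gt0.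
have /cvgrPdist_lt/(_ _ e20) D_near := merit_dderiv_cvg (d := d) Ex.
exists ([set d' | `|d - d'| < e / 2 / L],
   [set t | 0 < t /\ `|merit_dderiv A C F x d - theta (x + t *: d) / t| < e / 2]).
  split=> /=.
    apply/nbhs_ballP; exists (e / 2 / L); first by rewrite /= divr_gt0.
    by move=> d'; rewrite -ball_normE.
  by near=> t; split; near: t => //; exact: nbhs_right_gt.
move=> [d' t] /= [dd' [t0 Dt]].
rewrite (le_lt_trans (ler_distD (theta (x + t *: d) / t) _ _))// [e]splitr ltr_leD//.
rewrite -mulrBl normrM normfV (gtr0_norm t0) ler_pdivrMr//.
have lipt u v : theta (x + t *: u) - theta (x + t *: v) <= L * `|u - v| * t.
  rewrite lerBlDl (le_trans (lip _ (x + t *: v)))// lerD2l.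
  by rewrite opprD addrACA subrr add0r -scalerBr normrZ gtr0_norm// -mulrA [t * _]mulrC.
apply: (@le_trans _ _ (L * `|d - d'| * t)).
  by rewrite ler_norml lerNl opprB lipt {1}distrC lipt.
by rewrite ler_pM2r// mulrC -ler_pdivlMr// ltW.
Unshelve. all: by end_near. Qed.

Lemma merit_hadamard_seq (x d : X) (t : nat -> R) (dk : nat -> X) :
  weakly_efficient A C F x ->
  (forall k, 0 < t k) -> t @ \oo --> 0 -> dk @ \oo --> d ->
  theta (x + t k *: dk k) / t k @[k --> \oo] --> merit_dderiv A C F x d.
Proof.
move=> Ex t_gt0 t0 dkd.
apply: (cvg_comp (fun k => (dk k, t k)) _ _ (merit_hadamard (d := d) Ex)).
(* Positivity of every [t k] turns convergence to 0 into convergence along [0^'+]. *)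
apply: cvg_pair => // P /t0 tP.
have {}tP : \forall k \near \oo, 0 < t k -> P (t k) := tP.
by apply: (filterS _ tP : \forall k \near \oo, P (t k)) => k; exact.
Qed.

(** * Sharp growth, error bounds and tangency *)

(** Around a tangent unit direction the quotient stays above [M]; around a non-tangent one no nearby
    point of [A] occurs. Compactness of the sphere yields one radius for all directions. *)
Lemma merit_sharp (x : X) (M : R) : finite_dimensional X ->
  weakly_efficient A C F x -> (M%:E < min_slope A C F x)%E ->
  exists2 delta : R, 0 < delta &
    forall y, A y -> ball x delta y -> M * `|y - x| <= theta y.
Proof.
move=> finX Ex M_lt; have /weakly_efficientP[Ax tx0] := Ex.
have near_sphere (d : X) : `|d| = 1 -> \forall d' \near d & t \near 0^'+,
    A (x + t *: d') -> M * t <= theta (x + t *: d').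
  move=> d1; have [Td|/tangent_coneNnear] := pselect (tangent_cone A x d); last first.
    by apply: filterS => -[d' t] /=.
  have Md : M < merit_dderiv A C F x d.
    rewrite -lte_fin; apply: lt_le_trans M_lt _.
    by apply: ereal_inf_lbound; exists d.
  have /cvgr_gt/(_ _ Md) := merit_hadamard (d := d) Ex.
  have : \forall d' \near d & t \near (0 : R)^'+, 0 < t.
    by exists (setT, [set t | 0 < t]); [split; [exact: filterT|exact: nbhs_right_gt]|move=> [? ?] []].
  apply: filterS2 => -[d' t] /= t0 Mt _.
  by rewrite ltW// -ltr_pdivlMr.
have /compact_near_coveringP := compact_sphere finX.
move=> /(_ R (0 : R)^'+ _ _ near_sphere)/nbhs_ballP[delta /= d0 sphereM].
exists delta => // y Ay; rewrite -ball_normE/= distrC => xy.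
(* Write [y] in polar form around [x]; the centre has no direction and is treated apart. *)
have [->|yx] := eqVneq y x; first by rewrite subrr normr0 mulr0 tx0.
have yx0 : 0 < `|y - x| by rewrite normr_gt0 subr_eq0.
have yE : x + `|y - x| *: (`|y - x|^-1 *: (y - x)) = y.
  by rewrite scalerA divff ?gt_eqF// scale1r addrC subrK.
rewrite -[in leRHS]yE; apply: sphereM => //; last by rewrite yE.
  by rewrite -ball_normE/= sub0r normrN normr_id.
by rewrite /= normrZ normfV normr_id mulVf// gt_eqF.
Qed.

(** Since [x] is isolated, the error bound along a sequence realizing [d] reads
    [|t k *: dk k| <= tau * theta]; divide by [tau * t k] and pass to the limit. *)
Lemma error_bound_const_ge_slope (x d : X) (tau eta : R) :
  weakly_efficient A C F x -> 0 < eta ->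
  (forall u, weakly_efficient A C F u -> ball x eta u -> u = x) ->
  0 < tau -> error_bound_const A C F x tau ->
  tangent_cone A x d -> `|d| = 1 -> tau^-1 <= merit_dderiv A C F x d.
Proof.
move=> Ex eta0 isolated tau0 [delta delta0 bound] [t [dk [t_gt0 t0 dkd Ak]]] d1.
have quot_cvg := merit_hadamard_seq Ex t_gt0 t0 dkd.
have norm_cvg : tau^-1 * `|dk k| @[k --> \oo] --> tau^-1.
  by rewrite -[X in _ --> X]mulr1 -d1; apply: cvgMr; exact: cvg_norm.
apply: (ler_cvg_to norm_cvg quot_cvg).
(* Other efficient points are at least [eta] away from [x], so a point within [eta / 2] of [x] is no
   closer to them than to [x]. *)
have eta20 : 0 < eta / 2 by rewrite divr_gt0.
have near_delta := near_scaled_norm_lt delta0 t0 dkd.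
have near_eta := near_scaled_norm_lt eta20 t0 dkd.
near=> k.
have k_delta : `|t k *: dk k| < delta by near: k.
have k_eta : `|t k *: dk k| < eta / 2 by near: k.
rewrite ler_pdivlMr// -mulrA mulrC ler_pdivrMr// [_ * tau]mulrC.
rewrite [_ * t k]mulrC -[t k]gtr0_norm// -normrZ gtr0_norm//.
have xk : ball x delta (x + t k *: dk k).
  by rewrite -ball_normE/= opprD addNKr normrN.
have := bound _ (Ak k) xk; rewrite -(fineK (merit_fin_num (x + t k *: dk k))).
rewrite -EFinM -lee_fin; apply: le_trans.
apply/ereal_infP => _ [u Eu <-]; rewrite lee_fin.
have [->|ux] := eqVneq u x; first by rewrite addrC addKr.
have xu : eta <= `|x - u|.
  by rewrite leNgt; apply/negP => xu; move/eqP: ux; apply; apply: isolated => //; rewrite -ball_normE.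
have := ler_distD (x + t k *: dk k) x u.
rewrite opprD addNKr normrN; lra.
Unshelve. all: by end_near. Qed.

Lemma error_bound_tangent_cone (x d : X) : weakly_efficient A C F x ->
  local_error_bound A C F x -> tangent_cone A x d ->
  merit_dderiv A C F x d = 0 -> tangent_cone (weakly_efficient A C F) x d.
Proof.
move=> Ex [tau tau0 [delta delta0 bound]] [t [dk [t_gt0 t0 dkd Ak]]] d0.
have := merit_hadamard_seq Ex t_gt0 t0 dkd; rewrite d0 => quot_cvg.
pose xk k := x + t k *: dk k.
(* The term [k.+1%:R^-1] gives strict slack, since the distance to the efficient set need not be
   attained. *)
pose r k := tau * (theta (xk k) / t k) + k.+1%:R^-1.
have r_cvg : r k @[k --> \oo] --> 0.
  by rewrite -[X in _ --> X]addr0 -[in X in X + _](mulr0 tau); apply: cvgD; [exact: cvgMr|exact: cvg_harmonic].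
have /choice[u uP] (k : nat) : exists u, weakly_efficient A C F u /\
    (`|t k *: dk k| < delta -> `|xk k - u| < t k * r k).
  (* Where the error bound does not apply, [x] serves as a placeholder; this affects only finitely
     many indices. *)
  have [k_delta|] := ltP `|t k *: dk k| delta; last by move=> _; exists x.
  have xkx : ball x delta (xk k) by rewrite -ball_normE/= opprD addNKr normrN.
  have [|u Eu ux] := @dist_set_lt _ _ (weakly_efficient A C F) (xk k) (t k * r k).
    apply: le_lt_trans (bound _ (Ak k) xkx) _.
    rewrite -(fineK (merit_fin_num _)) -EFinM lte_fin /r mulrDr mulrCA.
    by rewrite [t k * (_ / _)]mulrC divfK ?gt_eqF// ltrDl mulr_gt0.
  by exists u.
exists t, (fun k => (t k)^-1 *: (u k - x)); split=> //; last first.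
  by move=> k; rewrite scalerA divff ?gt_eqF// scale1r addrC subrK; have [] := uP k.
(* The directions from [x] to [u k], rescaled by [t k], differ from [dk k] by at most [r k], so they
   also tend to [d]. *)
have near_delta := near_scaled_norm_lt delta0 t0 dkd.
have diff_cvg : dk k - (t k)^-1 *: (u k - x) @[k --> \oo] --> 0.
  apply/norm_cvg0P; apply: (squeeze_cvgr _ (cvg_cst 0) r_cvg); near=> k.
  have k_delta : `|t k *: dk k| < delta by near: k.
  have /ltW le_r := (uP k).2 k_delta.
  rewrite normr_ge0/= -(ler_pM2l (t_gt0 k)); apply: le_trans le_r.
  rewrite -[X in X * _]gtr0_norm// -normrZ scalerBr scalerA divff ?gt_eqF// scale1r.
  by rewrite opprB addrCA addrA.
rewrite -[d]subr0.
have -> : (fun k => (t k)^-1 *: (u k - x)) =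
    (fun k => dk k - (dk k - (t k)^-1 *: (u k - x))).
  by apply/funext => k; rewrite subKr.
exact: cvgB.
Unshelve. all: by end_near. Qed.

End Merit.

(** * The modulus as the reciprocal of the minimal slope *)

Theorem theorem6p5 (R : realType) (X : normedModType R)
    (Y : completeNormedModType R) (A : set X) (C : set Y) (F : {linear X -> Y})
    (xbar : X)
    (finX : finite_dimensional X)
    (A_neq0 : A !=set0) (A_closed : closed A) (A_convex : convex_set A)
    (C_closed : closed C) (C_convex : convex_set C) (C_cone : is_cone C)
    (intC_neq0 : interior C !=set0)
    (F_cont : continuous F)
    (F_intC : range F `&` interior C !=set0)
    (merit_fin : forall x : X, (merit A C F x < +oo)%E)
    (xbar_eff : weakly_efficient A C F xbar) :
  ((0 < min_slope A C F xbar)%E ->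
     [/\ local_error_bound A C F xbar,
         error_bound_modulus A C F xbar = ((min_slope A C F xbar)^-1)%E &
         ((min_slope A C F xbar)^-1 < +oo)%E]) /\
  (min_slope A C F xbar = 0%E ->
   (exists d0 : X,
      [/\ tangent_cone A xbar d0,
          ~ tangent_cone (weakly_efficient A C F) xbar d0 &
          merit_dderiv A C F xbar d0 = 0]) ->
   ~ local_error_bound A C F xbar /\ error_bound_modulus A C F xbar = +oo%E).
Proof.
have C_neq0 : C !=set0 by have [c /interior_subset Cc] := intC_neq0; exists c.
have Ex := xbar_eff.
have meritfin := merit_fin_num A_neq0 C_neq0 merit_fin.
split=> [slope_gt0|_ [d0 [Ad0 Ed0 slope0]]]; last first.
  have no_bound : ~ local_error_bound A C F xbar.
    by move=> bound; apply: Ed0; exact: error_bound_tangent_cone.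
  split=> //; apply/ereal_inf_pinfty => _ [tau [tau0 bound] <-].
  by exfalso; apply: no_bound; exists tau.
set phi := min_slope A C F xbar in slope_gt0 *.
have phiV_lty : (phi^-1 < +oo)%E by rewrite ltey inve_eqy gt_eqF.
have phiV_ge0 : (0 <= phi^-1)%E by rewrite inve_ge0 ltW.
(* Comparing [s] with [phi^-1] rather than [s^-1] with [phi] also covers [phi = +oo], whose inverse
   is 0; sharp growth is used with [M = s^-1]. *)
have sharp (s : R) : (phi^-1 < s%:E)%E -> 0 < s /\
    exists2 delta : R, 0 < delta & forall y, A y -> ball xbar delta y ->
      `|y - xbar| <= s * fine (merit A C F y).
  move=> lt_s; have s0 : 0 < s by rewrite -lte_fin (le_lt_trans phiV_ge0).
  split=> //; have [|delta delta0 sharp] := @merit_sharp _ _ _ A C F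
      A_neq0 A_convex C_neq0 C_cone F_cont merit_fin xbar s^-1 finX Ex.
    move: lt_s; rewrite inve_plt ?inE ?lee_fin ?ltW//.
    by rewrite inver gt_eqF.
  exists delta => // y Ay /(sharp y Ay).
  by rewrite mulrC ler_pdivrMr// mulrC.
have bound_gt (s : R) : (phi^-1 < s%:E)%E ->
    0 < s /\ error_bound_const A C F xbar s.
  move=> /sharp[s0 [delta delta0 bound]]; split=> //; exists delta => // y Ay xy.
  apply: le_trans (dist_set_le y Ex) _.
  by rewrite -(fineK (meritfin y)) -EFinM lee_fin bound.
have [v vE] : exists v : R, (phi^-1 = v%:E)%E.
  by exists (fine (phi^-1)%E); rewrite fineK// ge0_fin_numE.
have lt_v1 : (phi^-1 < (v + 1)%:E)%E by rewrite vE lte_fin ltrDl.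
have [v10 bound1] := bound_gt _ lt_v1.
split=> //; first by exists (v + 1) => //; apply: bound1.
apply/eqP; rewrite eq_le; apply/andP; split.
  (* Every [v + e] with [e > 0] is an admissible constant, so the modulus is at most [v]. *)
  apply/lee_addgt0Pr => e e0; apply: ereal_inf_lbound.
  exists (v + e); last by rewrite EFinD -vE.
  by apply: bound_gt; rewrite vE lte_fin ltrDl.
apply/ereal_infP => _ [tau [tau0 bound] <-].
rewrite inve_ple ?inE ?(ltW slope_gt0) ?lee_fin ?(ltW tau0)//.
rewrite inver gt_eqF// /phi; apply/ereal_infP => _ [d [Td d1] <-].
have [s0 [eta eta0 iso]] := sharp _ lt_v1.
(* At an efficient point [theta] vanishes, so sharp growth forces it to coincide with [xbar]. *)
have isolated u : weakly_efficient A C F u -> ball xbar eta u -> u = xbar.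
  move=> /(weakly_efficientP A_neq0 C_neq0 C_cone merit_fin)[Au u0] /(iso u Au).
  by rewrite u0 mulr0 normr_le0 subr_eq0 => /eqP.
rewrite lee_fin; exact: (error_bound_const_ge_slope A_neq0 A_convex C_neq0 C_cone
  F_cont merit_fin Ex eta0 isolated tau0 bound Td d1).
Qed.
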